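(* Let $\mathcal X$ be a Hilbert space and let $C_0,\alpha,c_1>0$ be constants. (1) If $d_n\le C_0n^{-\alpha}$ for every $n\ge1$, then for every $1\le n\le\mathcal N$ and every $\varphi\in F$, $\|\varphi-\mathcal J_n[\varphi]\|_{\mathcal X}\le(1+\Lambda_n)\,C_0\,\beta_n\,n^{-\alpha}$, where $\beta_1:=2(1+\eta^{-1})$ and, for $n\ge2$ written as $n=4\ell+k$ with $\ell\in\{0,1,\dots\}$, $k\in\{0,1,2,3\}$, $$\beta_n:=\sqrt{2\beta_{\ell_1}}\,\frac{1}{\prod_{i=1}^{\ell_2}\gamma_{\ell_1-\lceil k/4\rceil+i}^{1/\ell_2}}\,(2\sqrt2)^\alpha,\qquad \ell_1=2\ell+\lfloor2k/3\rfloor,\quad\ell_2=2(\ell+\lceil k/4\rceil).$$ (2) If $C_0\ge1$ and $d_n\le C_0e^{-c_1n^\alpha}$ for every $n\ge1$, then for every $1\le n\le\mathcal N$ and every $\varphi\in F$, $\|\varphi-\mathcal J_n[\varphi]\|_{\mathcal X}\le(1+\Lambda_n)\,C_0\,\beta_n\,e^{-c_2n^\alpha}$, where $c_2:=c_12^{-2\alpha-1}$, $\beta_1:=2(1+\eta^{-1})$ and, for $n\ge2$, $$\beta_n:=\sqrt2\,\frac{1}{\prod_{i=1}^{2\lfloor n/2\rfloor}\gamma_i^{1/(2\lfloor n/2\rfloor)}}.$$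
   Context: Setting. $\mathcal X$ is a real Hilbert space of functions defined over a domain $\overline\Omega\subset\mathbb R^d$ or $\mathbb C^d$, with induced norm $\|\cdot\|_{\mathcal X}$ and dual $\mathcal X'$; $F\subset\mathcal X$ is compact with $\|\varphi\|_{\mathcal X}\le 1$ for all $\varphi\in F$; $\mathcal N\in\{1,2,\dots\}\cup\{\infty\}$ is such that $\dim\operatorname{span}F>\mathcal N$ (infinite-dimensional if $\mathcal N=\infty$); indices $n$ are always finite integers. $\Sigma\subset\mathcal X'$ is a dictionary such that: (P1) $\|\sigma\|_{\mathcal X'}=1$ for all $\sigma\in\Sigma$; (P2) if $\varphi\in\operatorname{span}F$ and $\sigma(\varphi)=0$ for all $\sigma\in\Sigma$, then $\varphi=0$; (P3) for all $\varphi\in\operatorname{span}F$ the set $\{\sigma(\varphi):\sigma\in\Sigma\}\subset\mathbb R$ is closed. GEIM weak greedy algorithm. Fix $\eta\in(0,1]$. Let $F_0\subset F_1\subset\cdots$ be subsets of $F$ and $\widetilde\Sigma_0\subset\widetilde\Sigma_1\subset\cdots$ subsets of $\Sigma$ (all finite if $\eta<1$; $F_n=F$ for all $n$ if $\eta=1$) such that $\widetilde\Sigma_n$ satisfies (P2) and (P3) with $F$ replaced by $F_n$. Choose $\varphi_0\in\operatorname{argmax}_{\varphi\in F_0}\|\varphi\|_{\mathcal X}$ and $\sigma_0\in\operatorname{argmax}_{\sigma\in\widetilde\Sigma_0}|\sigma(\varphi_0)|$. For $1\le n\le\mathcal N$ put $X_n=\operatorname{span}\{\varphi_0,\dots,\varphi_{n-1}\}$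 and let $\mathcal J_n:\mathcal X\to X_n$ be the linear operator for which $\mathcal J_n[\varphi]$ is the unique element of $X_n$ with $\sigma_i(\mathcal J_n[\varphi])=\sigma_i(\varphi)$, $i=0,\dots,n-1$ (this is well posed and $\dim X_n=n$); then choose $\varphi_n\in\operatorname{argmax}_{\varphi\in F_n}\|\varphi-\mathcal J_n[\varphi]\|_{\mathcal X}$ and $\sigma_n\in\operatorname{argmax}_{\sigma\in\widetilde\Sigma_n}|\sigma(\varphi_n-\mathcal J_n[\varphi_n])|$. The sets $F_n$ are such that $\max_{F_0}\|\varphi\|_{\mathcal X}\ge\eta\max_F\|\varphi\|_{\mathcal X}$ and $\max_{\varphi\in F_n}\|\varphi-\mathcal J_n[\varphi]\|_{\mathcal X}\ge\eta\max_{\varphi\in F}\|\varphi-\mathcal J_n[\varphi]\|_{\mathcal X}$ for $1\le n\le\mathcal N$. Notation. $\Lambda_n=\sup_{\varphi\in\mathcal X\setminus\{0\}}\|\mathcal J_n[\varphi]\|_{\mathcal X}/\|\varphi\|_{\mathcal X}$ (Lebesgue constant) and $\gamma_n=\eta/(1+\Lambda_n)$ for $1\le n\le\mathcal N$. The Kolmogorov $n$-width is $d_n=d_n(F,\mathcal X)=\inf_{Y\subset\mathcal X,\ \dim Y\le n}\ \max_{u\in F}\ \inf_{v\in Y}\|u-v\|_{\mathcal X}$ ($Y$ linear subspaces). *)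

(* Defs.v *)
From HB Require Import structures.
From mathcomp Require Import all_boot all_order all_algebra.
From mathcomp Require Import all_classical all_reals all_analysis.
From mathcomp Require Import zify.
Import Order.TTheory GRing.Theory Num.Theory.
Import numFieldNormedType.Exports.

Set Implicit Arguments.
Unset Strict Implicit.
Unset Printing Implicit Defensive.

Local Open Scope classical_set_scope.
Local Open Scope ring_scope.

Section LinearSpans.
Variables (R : realType) (X : lmodType R).

Definition lspan (A : set X) : set X :=
  [set x | exists n (c : 'I_n -> R) (v : 'I_n -> X),
     (forall i, A (v i)) /\ x = \sum_(i < n) c i *: v i].

(* [Y] is a linear subspace of dimension at most [n]. *)
Definition subspace_dim_le (Y : set X) (n : nat) : Prop :=
  exists v : 'I_n -> X, Y = lspan (range v).

End LinearSpans.

Definition is_argmax (T : Type) (R : realType) (A : set T) (f : T -> R) (x : T) :=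
  A x /\ forall y, A y -> f y <= f x.

(* The operator norm of [f]. As [sup] of an unbounded set is 0, it is only
   meaningful for bounded [f]. *)
Definition opnorm (R : realType) (V W : normedModType R) (f : V -> W) : R :=
  sup [set `|f x| / `|x| | x in [set x | x != 0]].

(* For bounded nonempty [F] all the sets involved are nonempty and bounded on
   the relevant side; the supremum is a maximum when [F] is compact. *)
Definition kolmogorov_width (R : realType) (X : normedModType R) (F : set X)
    (n : nat) : R :=
  inf [set sup [set inf [set `|u - v| | v in Y] | u in F]
      | Y in [set Y | subspace_dim_le Y n]].

(* [None] stands for infinity. *)
Definition index_le (n : nat) (N : option nat) : bool :=
  if N is Some m then (n <= m)%N else true.

Section GEIM.
Variables (R : realType) (X : completeNormedModType R).

(* Elements of the dual are the [s : {linear X -> R^o}] that are continuous. *)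
Definition dictionary_P1 (S : set {linear X -> R^o}) : Prop :=
  forall s, S s -> continuous s /\ opnorm s = 1.

Definition dictionary_P2 (F : set X) (S : set {linear X -> R^o}) : Prop :=
  forall f, lspan F f -> (forall s, S s -> s f = 0) -> f = 0.

Definition dictionary_P3 (F : set X) (S : set {linear X -> R^o}) : Prop :=
  forall f, lspan F f ->
    closed [set (s : {linear X -> R^o}) f | s in S].

(* [X_n], the span of [phi 0, ..., phi n.-1]. *)
Definition geim_space (phi : nat -> X) (n : nat) : set X :=
  lspan (phi @` `I_n).

(* [J_n[f]]. For a run of the algorithm and [n <= N] exactly one [v] satisfies
   the condition; [xget] only serves to make the definition total. *)
Definition geim_interp (phi : nat -> X) (sigma : nat -> {linear X -> R^o})
    (n : nat) (f : X) : X :=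
  xget 0 [set v | geim_space phi n v /\
                  forall i, (i < n)%N -> sigma i v = sigma i f].

Definition lebesgue_const (phi : nat -> X) (sigma : nat -> {linear X -> R^o})
    (n : nat) : R :=
  opnorm (geim_interp phi sigma n).

Record geim_setting (F : set X) (N : option nat)
    (Sigma : set {linear X -> R^o}) : Prop := GeimSetting {
  geim_compact : compact F;
  geim_norm_le1 : forall f, F f -> `|f| <= 1;
  geim_N_ge1 : N <> Some 0%N;
  (* [dim span F > N], and infinite when [N = None] *)
  geim_dim : forall n, index_le n N -> ~ subspace_dim_le (lspan F) n;
  geim_P1 : dictionary_P1 Sigma;
  geim_P2 : dictionary_P2 F Sigma;
  geim_P3 : dictionary_P3 F Sigma
}.

(* [phi] and [sigma] are a possible output of the weak greedy algorithm run
   with the sets [Fs] and [Ss]; only indices up to [N] matter. *)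
Record geim_run (F : set X) (N : option nat) (Sigma : set {linear X -> R^o})
    (eta : R) (Fs : nat -> set X) (Ss : nat -> set {linear X -> R^o})
    (phi : nat -> X) (sigma : nat -> {linear X -> R^o}) : Prop := GeimRun {
  geim_eta : 0 < eta <= 1;
  geim_Fs_sub : forall n, index_le n N -> Fs n `<=` F;
  geim_Fs_incr : forall n, index_le n.+1 N -> Fs n `<=` Fs n.+1;
  geim_Ss_sub : forall n, index_le n N -> Ss n `<=` Sigma;
  geim_Ss_incr : forall n, index_le n.+1 N -> Ss n `<=` Ss n.+1;
  geim_finite : eta < 1 ->
    forall n, index_le n N -> finite_set (Fs n) /\ finite_set (Ss n);
  geim_full : eta = 1 -> forall n, index_le n N -> Fs n = F;
  geim_Ss_P2 : forall n, index_le n N -> dictionary_P2 (Fs n) (Ss n);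
  geim_Ss_P3 : forall n, index_le n N -> dictionary_P3 (Fs n) (Ss n);
  geim_phi0 : is_argmax (Fs 0%N) (fun f => `|f|) (phi 0%N);
  geim_sigma0 : is_argmax (Ss 0%N)
    (fun s : {linear X -> R^o} => `|s (phi 0%N)|) (sigma 0%N);
  geim_phi : forall n, (1 <= n)%N -> index_le n N ->
    is_argmax (Fs n) (fun f => `|f - geim_interp phi sigma n f|) (phi n);
  geim_sigma : forall n, (1 <= n)%N -> index_le n N ->
    is_argmax (Ss n)
      (fun s : {linear X -> R^o} =>
         `|s (phi n - geim_interp phi sigma n (phi n))|) (sigma n);
  geim_weak0 : eta * sup [set `|f| | f in F] <= sup [set `|f| | f in Fs 0%N];
  geim_weak : forall n, (1 <= n)%N -> index_le n N ->
    eta * sup [set `|f - geim_interp phi sigma n f| | f in F]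
      <= sup [set `|f - geim_interp phi sigma n f| | f in Fs n]
}.

End GEIM.

Section Constants.
Variables (R : realType) (eta : R) (gamma : nat -> R).

(* The recursion calls itself at [l1 < n]; [fuel >= n] is enough, see
   [beta_algE]. For [k < 4], [(k + 3) %/ 4] is the ceiling of [k / 4]. *)
Fixpoint beta_alg_fuel (alpha : R) (fuel n : nat) : R :=
  if fuel isn't fuel'.+1 then 0 else
  if (n <= 1)%N then 2 * (1 + eta^-1) else
  let l := (n %/ 4)%N in
  let k := (n %% 4)%N in
  let l1 := (2 * l + (2 * k) %/ 3)%N in
  let l2 := (2 * (l + (k + 3) %/ 4))%N in
  Num.sqrt (2 * beta_alg_fuel alpha fuel' l1)
  * (\prod_(1 <= i < l2.+1) gamma (l1 - (k + 3) %/ 4 + i)%N `^ l2%:R^-1)^-1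
  * (2 * Num.sqrt 2) `^ alpha.

(* [beta_n] for algebraically decaying widths. *)
Definition beta_alg (alpha : R) (n : nat) : R := beta_alg_fuel alpha n n.

(* [beta_n] for exponentially decaying widths; [2 * n./2] is twice the floor of
   [n / 2]. *)
Definition beta_exp (n : nat) : R :=
  if (n <= 1)%N then 2 * (1 + eta^-1) else
  Num.sqrt 2
  * (\prod_(1 <= i < (2 * n./2).+1) gamma i `^ (2 * n./2)%:R^-1)^-1.

Lemma beta_alg_fuelE alpha fuel fuel' n : (0 < n)%N ->
  (n <= fuel)%N -> (n <= fuel')%N ->
  beta_alg_fuel alpha fuel n = beta_alg_fuel alpha fuel' n.
Proof.
elim: fuel fuel' n => [|fuel IH] [|fuel'] n n0 nf nf'; try lia.
rewrite /=; case: leqP => // n1.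
by rewrite (IH fuel') //; lia.
Qed.

Lemma beta_alg1 alpha : beta_alg alpha 1 = 2 * (1 + eta^-1).
Proof. by []. Qed.

Lemma beta_algE alpha (l k : nat) : (k < 4)%N -> (2 <= 4 * l + k)%N ->
  let l1 := (2 * l + (2 * k) %/ 3)%N in
  let l2 := (2 * (l + (k + 3) %/ 4))%N in
  beta_alg alpha (4 * l + k) =
  Num.sqrt (2 * beta_alg alpha l1)
  * (\prod_(1 <= i < l2.+1) gamma (l1 - (k + 3) %/ 4 + i)%N `^ l2%:R^-1)^-1
  * (2 * Num.sqrt 2) `^ alpha.
Proof.
move=> k4 n2 l1 l2; rewrite /beta_alg.
case En: (4 * l + k)%N n2 => [|n] // n2.
rewrite [LHS]/= leqNgt n2 /=.
have -> : (n.+1 %/ 4)%N = l by lia.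
have -> : (n.+1 %% 4)%N = k by lia.
by rewrite (@beta_alg_fuelE alpha n l1) //; rewrite /l1; lia.
Qed.

End Constants.

(* Main.v *)
Require Import Defs.
From HB Require Import structures.
From mathcomp Require Import all_boot all_order all_algebra.
From mathcomp Require Import all_classical all_reals all_analysis.
From mathcomp Require Import ring lra zify.
Import Order.TTheory GRing.Theory Num.Theory.
Import numFieldNormedType.Exports.
Local Open Scope classical_set_scope.
Local Open Scope ring_scope.

Set Implicit Arguments.
Unset Strict Implicit.
Unset Printing Implicit Defensive.

(** On a Hilbert space let [tau_n] be the largest distance from an element of [F]
    to [X_n]. As the interpolation operator is a bounded projection onto [X_n],
    the greedy choice gives [dist (phi_n, X_n) >= gamma_n tau_n], and the
    interpolation error is at most [(1 + Lambda_n) tau_n]. After Gram-Schmidt,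
    [phi_k, ..., phi_(k+2m-1)] modulo [X_k] have a triangular coordinate matrix
    [A] whose diagonal entries are the distances [dist (phi_j, X_j)]. The rows of
    [A] have norm at most [tau_k] and lie within [d_m] of an [m]-dimensional
    space, so [det A ^ 2 <= (2 tau_k d_m) ^ (2m)]. Hence
    [tau_(k+2m-1) <= sqrt (2 tau_k d_m) / prod_j gamma_j ^ (1/2m)]; the algebraic
    rates follow by strong induction and the exponential ones from
    [tau_1 <= 1]. *)

(** * Determinant bound *)

Definition posdef (R : realFieldType) n (H : 'M[R]_n) : Prop :=
  H^T = H /\ forall x : 'rV_n, x != 0 -> 0 < (x *m H *m x^T) 0 0.

Lemma posdef_diag (R : realFieldType) n (H : 'M[R]_n) i : posdef H -> 0 < H i i.
Proof.
move=> [_ /(_ (delta_mx 0 i))].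
rewrite -rowE trmx_delta -colE !mxE; apply.
by apply/eqP => /matrixP/(_ 0 i); rewrite !mxE !eqxx /=; exact/eqP/oner_neq0.
Qed.

(** Induction by Schur complement: eliminating the first row and column leaves a positive definite
    [S] with [\det H = H 0 0 * \det S], and the diagonal entries of [S] are at most those of [H'],
    since a nonnegative multiple of a square is subtracted from each. *)
Lemma hadamard (R : realFieldType) n (H : 'M[R]_n) :
  posdef H -> \det H <= \prod_i H i i.
Proof.
elim: n H => [|n IH] H pH; first by rewrite det_mx00 big_ord0.
have [sH pdH] := pH.
rewrite -[n.+1]/(1 + n)%N in H pH sH pdH *.
set a := ulsubmx H; set b := ursubmx H; set H' := drsubmx H.
have HE : H = block_mx a b b^T H'.
  rewrite -[LHS]submxK; congr (block_mx _ _ _ _).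
  by rewrite -[in LHS]sH trmx_ursub.
have aE : a = (H 0 0)%:M.
  by rewrite [a]mx11_scalar !mxE; congr (H _ _)%:M; exact/val_inj.
have a0 : 0 < H 0 0 by exact: posdef_diag.
pose c := (H 0 0)^-1.
pose S := H' - c *: (b^T *m b).
have sS : S^T = S.
  rewrite /S linearB linearZ /= trmx_mul trmxK; congr (_ - _).
  by rewrite /H' trmx_drsub sH.
have pS : posdef S.
  split => // x x0.
  (* This [y] minimizes the form of [H] among the extensions of [x]; the minimum is the value of the
     form of [S] at [x]. *)
  pose y : 'rV_(1 + n) := row_mx (- (c *: (x *m b^T))) x.
  have y0 : y != 0.
    apply: contraNneq x0 => y0.
    by rewrite -[x](row_mxKr (- (c *: (x *m b^T)))) -/y y0 linear0.
  have := pdH _ y0; congr (_ < _); congr (fun_of_matrix _ 0 0).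
  rewrite HE mul_row_block aE tr_row_mx mul_row_col.
  rewrite mul_mx_scalar !mulNmx scalerN scalerA divff ?gt_eqF// scale1r addNr.
  rewrite mul0mx add0r /S mulmxBr mulmxBl -scalemxAl -scalemxAr.
  by rewrite mulmxDl addrC mulNmx -scalemxAl mulmxA -scalemxAl.
have -> : \det H = H 0 0 * \det S.
  have: \det (block_mx 1%:M 0 (- (c *: b^T)) 1%:M *m H) = H 0 0 * \det S.
    rewrite {1}HE mulmx_block !mul1mx !mul0mx !addr0 aE mul_mx_scalar.
    rewrite scalerN scalerA divff ?gt_eqF// scale1r addNr det_ublock.
    by rewrite det_scalar1 mulNmx -scalemxAl addrC.
  by rewrite det_mulmx det_lblock !det1 !mul1r.
rewrite big_ord_recl ler_pM2l //.
apply: le_trans (IH _ pS) _.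
apply: ler_prod => i _.
rewrite (ltW (posdef_diag i pS)) /=.
rewrite !mxE big_ord1 !mxE.
rewrite (_ : rshift 1 i = lift 0 i); last exact/val_inj.
have : 0 <= c * (H (lshift n 0) (lift 0 i) * H (lshift n 0) (lift 0 i)).
  rewrite -expr2 mulr_ge0 ?sqr_ge0 ?invr_ge0 ?ltW //.
lra.
Qed.

(** The Weinstein-Aronszajn identity: eliminating the lower left block of [B] by row operations
    gives the left side, and by column operations the right side, where the remaining [m] by [m]
    block is diagonal. *)
Lemma det_scalar_add_gram (R : fieldType) m n (V : 'M[R]_(m, n)) (s c : R) :
  s != 0 -> is_diag_mx (V *m V^T) ->
  \det (s%:M + c *: (V^T *m V)) =
  s ^+ n * \prod_i (1 + c / s * (V *m V^T) i i).
Proof.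
move=> s0 dV.
pose B : 'M[R]_(m + n) := block_mx 1%:M V (- (c *: V^T)) s%:M.
have <- : \det B = \det (s%:M + c *: (V^T *m V)).
  have: \det (block_mx 1%:M 0 (c *: V^T) 1%:M *m B) =
      \det (s%:M + c *: (V^T *m V)).
    rewrite mulmx_block !mul1mx !mul0mx !addr0 mulmx1 subrr det_ublock det1 mul1r.
    by rewrite addrC scalemxAl.
  by rewrite det_mulmx det_lblock !det1 !mul1r.
have: \det (B *m block_mx 1%:M 0 ((c / s) *: V^T) 1%:M) =
      s ^+ n * \prod_i (1 + c / s * (V *m V^T) i i).
  rewrite mulmx_block !mulmx1 !mulmx0 !add0r mul_scalar_mx scalerA.
  rewrite mulrCA divff // mulr1 addNr det_ublock det_scalar mulrC; congr (_ * _).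
  rewrite -scalemxAr det_trig.
    by apply: eq_bigr => i _; rewrite !mxE eqxx.
  apply/is_trig_mxP => i j ij; rewrite !mxE.
  have /is_diag_mxP/(_ i j) := dV; rewrite mxE => ->.
    by rewrite mulr0 addr0 -val_eqE /= ltn_eqF.
  by rewrite neq_ltn ij.
by rewrite det_mulmx det_lblock !det1 !mulr1.
Qed.

Lemma mulmx_trmx_ge0 (R : realFieldType) n (x : 'rV[R]_n) :
  0 <= (x *m x^T) 0 0.
Proof. by rewrite mxE sumr_ge0 // => i _; rewrite mxE -expr2 sqr_ge0. Qed.

Lemma mulmx_trmx_gt0 (R : realFieldType) n (x : 'rV[R]_n) :
  x != 0 -> 0 < (x *m x^T) 0 0.
Proof.
move=> x0; rewrite lt_def mulmx_trmx_ge0 andbT; apply: contraNneq x0.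
rewrite mxE => /psumr_eq0P H; apply/eqP/rowP => i.
have /(_ i isT) : forall j, true -> x 0 j * x^T j 0 = 0.
  by apply: H => j _; rewrite mxE -expr2 sqr_ge0.
by rewrite !mxE => /eqP; rewrite mulf_eq0 orbb => /eqP.
Qed.

(** Bessel's inequality for orthogonal rows of norm at most 1, zero rows included: expand the
    nonnegative square norm of [x - z *m V]. *)
Lemma mx_bessel (R : realFieldType) m n (V : 'M[R]_(m, n)) (x : 'rV[R]_n) :
  is_diag_mx (V *m V^T) -> (forall i, (V *m V^T) i i <= 1) ->
  ((x *m V^T) *m (x *m V^T)^T) 0 0 <= (x *m x^T) 0 0.
Proof.
move=> dV V1; set z := x *m V^T.
have := mulmx_trmx_ge0 (x - z *m V).
have -> : (x - z *m V) *m (x - z *m V)^T =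
    x *m x^T - (z *m z^T) *+ 2 + z *m (V *m V^T) *m z^T.
  have xzV : x *m (z *m V)^T = z *m z^T by rewrite trmx_mul mulmxA.
  have zVx : z *m V *m x^T = z *m z^T.
    by rewrite [in RHS]/z trmx_mul trmxK mulmxA.
  rewrite linearB /= mulmxBr !mulmxBl xzV zVx (trmx_mul z V) !mulmxA.
  by rewrite opprB mulr2n opprD !addrA addrAC.
have : (z *m (V *m V^T) *m z^T) 0 0 <= (z *m z^T) 0 0.
  rewrite [leLHS]mxE [leRHS]mxE; apply: ler_sum => j _.
  rewrite [(z *m _) _ _]mxE (bigD1 j) //= big1 ?addr0 => [|k kj]; last first.
    by move/is_diag_mxP: dV => -> //; rewrite mulr0.
  rewrite mulrAC ![z^T _ _]mxE ler_piMr // -expr2 sqr_ge0 //.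
move: (x *m x^T) (z *m z^T) (z *m _ *m z^T) => P Q W.
by rewrite mulr2n !mxE; lra.
Qed.

(* Instead of completing the rows of [V] to an orthonormal basis, we weight the
   span of these rows by [delta ^+ 2] and its complement by [tau ^+ 2]: the
   Hadamard inequality for the weighted Gram matrix of the rows of [A] is the
   desired bound. *)
Lemma det_sqr_le (R : realFieldType) m n (A : 'M[R]_n) (V : 'M[R]_(m, n))
    (tau delta : R) :
  n = (m + m)%N -> is_diag_mx (V *m V^T) -> (forall i, (V *m V^T) i i <= 1) ->
  0 < delta <= tau ->
  (forall i, (row i A *m (row i A)^T) 0 0 <= tau ^+ 2) ->
  (forall i, (row i A *m (row i A)^T) 0 0 <=
     ((row i A *m V^T) *m (row i A *m V^T)^T) 0 0 + delta ^+ 2) ->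
  (\det A) ^+ 2 <= (2 * tau * delta) ^+ n.
Proof.
move=> nm dV V1 /andP[d0 dt] At Ad.
have t0 : 0 < tau by exact: lt_le_trans dt.
(* A singular [A] is set aside because [A *m S *m A^T] is positive definite only for invertible
   [A]. *)
have [->|A0] := eqVneq (\det A) 0.
  by rewrite expr0n exprn_ge0 // !mulr_ge0 // ltW.
have uA : A \in unitmx by rewrite unitmxE unitfE.
pose S : 'M[R]_n := (tau ^+ 2)%:M + (delta ^+ 2 - tau ^+ 2) *: (V^T *m V).
have SE (x : 'rV_n) : (x *m S *m x^T) 0 0 = tau ^+ 2 * (x *m x^T) 0 0 +
    (delta ^+ 2 - tau ^+ 2) * ((x *m V^T) *m (x *m V^T)^T) 0 0.
  rewrite mulmxDr mulmxDl mul_mx_scalar -scalemxAr -!scalemxAl.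
  by rewrite trmx_mul trmxK !mulmxA !mxE.
have t2 : 0 < tau ^+ 2 by rewrite exprn_gt0.
have d2 : 0 < delta ^+ 2 by rewrite exprn_gt0.
have dt2 : delta ^+ 2 <= tau ^+ 2 by rewrite lerXn2r // nnegrE ltW.
have Spd (x : 'rV_n) : x != 0 -> 0 < (x *m S *m x^T) 0 0.
  move=> x0; rewrite SE; have := mx_bessel x dV V1; have := mulmx_trmx_gt0 x0.
  move: (fun_of_matrix _ _ _) => p; move: (fun_of_matrix _ _ _) => q p0 qp.
  (* In this form both terms are visibly nonnegative, as Bessel's inequality says [q <= p]. *)
  have -> : tau ^+ 2 * p + (delta ^+ 2 - tau ^+ 2) * q =
     delta ^+ 2 * p + (tau ^+ 2 - delta ^+ 2) * (p - q) by ring.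
  by rewrite ltr_pwDl ?mulr_gt0 ?mulr_ge0 ?subr_ge0.
have Ssym : S^T = S.
  by rewrite linearD linearZ /= tr_scalar_mx trmx_mul trmxK.
have Hpd : posdef (A *m S *m A^T).
  split; first by rewrite !trmx_mul trmxK Ssym mulmxA.
  move=> x x0; have := Spd (x *m A); rewrite trmx_mul !mulmxA; apply.
  apply: contraNneq x0 => xA; by rewrite -(mulmxK uA x) xA mul0mx.
have := hadamard Hpd; rewrite !det_mulmx det_tr mulrAC -expr2 => detAS.
(* Each of the [m] factors is at least [delta ^+ 2 / tau ^+ 2]; as [n] is twice [m], the powers of
   [tau] and [delta] balance to exponent [n]. *)
have detS : (tau * delta) ^+ n <= \det S.
  rewrite det_scalar_add_gram ?gt_eqF //.
  have -> : (tau * delta) ^+ n =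
      (tau ^+ 2) ^+ n * \prod_(i < m) (delta ^+ 2 / tau ^+ 2).
    rewrite prodr_const card_ord nm !(exprD _ m m) expr_div_n.
    rewrite !(exprAC _ 2 m) (exprMn m tau).
    by field; rewrite expf_neq0 // gt_eqF.
  rewrite ler_pM2l ?exprn_gt0 //; apply: ler_prod => i _.
  rewrite divr_ge0 ?(ltW t2) ?(ltW d2) //= mulrBl divff ?gt_eqF //.
  have : delta ^+ 2 / tau ^+ 2 <= 1 by rewrite ler_pdivrMr ?mul1r.
  have := V1 i; move: (_ / _) (fun_of_matrix _ _ _) => r p p1 r1.
  have : 0 <= (1 - r) * (1 - p) by rewrite mulr_ge0 ?subr_ge0.
  lra.
(* With [p] the square norm of a row and [q] that of its coordinates along [V], the entry is
   [tau ^+ 2 * (p - q) + delta ^+ 2 * q], where [p - q <= delta ^+ 2] and [q <= p <= tau ^+ 2]. *)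
have diag : \prod_i (A *m S *m A^T) i i <= (2 * tau ^+ 2 * delta ^+ 2) ^+ n.
  rewrite -[X in _ ^+ X]card_ord -prodr_const.
  apply: ler_prod => i _; rewrite (ltW (posdef_diag i Hpd)) /=.
  have -> : (A *m S *m A^T) i i = (row i A *m S *m (row i A)^T) 0 0.
    by rewrite -row_mul mxE [RHS]mxE; apply: eq_bigr => j _; rewrite !mxE.
  rewrite SE; have := At i; have := Ad i; have := mx_bessel (row i A) dV V1.
  move: (fun_of_matrix _ _ _) => q; move: (fun_of_matrix _ _ _) => p.
  move=> h1 h2 h3; nra.
have td0 : 0 < (tau * delta) ^+ n by rewrite exprn_gt0 ?mulr_gt0.
rewrite -(ler_pM2r td0) -exprMn.
have -> : 2 * tau * delta * (tau * delta) = 2 * tau ^+ 2 * delta ^+ 2 by ring.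
apply: le_trans diag; apply: le_trans detAS.
by rewrite ler_wpM2l ?sqr_ge0.
Qed.

(** * Orthonormal sequences *)

Section Subspaces.
Variables (R : realType) (X : lmodType R).
Implicit Types A B : set X.

Definition lin_subspace B := B 0 /\ forall a x y, B x -> B y -> B (a *: x + y).

Lemma subspaceZ B a x : lin_subspace B -> B x -> B (a *: x).
Proof. by case=> B0 BL Bx; rewrite -[a *: x]addr0; apply: BL. Qed.

Lemma subspaceD B x y : lin_subspace B -> B x -> B y -> B (x + y).
Proof. by case=> _ BL Bx By; rewrite -[x]scale1r; apply: BL. Qed.

Lemma subspaceB B x y : lin_subspace B -> B x -> B y -> B (x - y).
Proof. by case=> _ BL Bx By; rewrite addrC -scaleN1r; apply: BL. Qed.

Lemma subspace_sum B (I : Type) (r : seq I) (P : pred I) (f : I -> X) :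
  lin_subspace B -> (forall i, P i -> B (f i)) -> B (\sum_(i <- r | P i) f i).
Proof.
by move=> sB Bf; elim/big_ind: _ => //; [exact: sB.1 | move=> *; exact: subspaceD].
Qed.

Lemma sub_lspan A : A `<=` lspan A.
Proof.
move=> x Ax; exists 1%N, (fun=> 1), (fun=> x); split=> //.
by rewrite big_ord1 scale1r.
Qed.

Lemma lspan_min A B : lin_subspace B -> A `<=` B -> lspan A `<=` B.
Proof.
move=> sB AB _ [n [c [v [Av ->]]]].
by apply: subspace_sum => // i _; apply: subspaceZ => //; exact/AB/Av.
Qed.

Lemma subspace_lspan A : lin_subspace (lspan A).
Proof.
split; first by exists 0%N, (fun=> 0), (fun=> 0); split=> [[]//|]; rewrite big_ord0.
move=> a _ _ [n [c [v [Av ->]]]] [m [d [w [Aw ->]]]].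
exists (n + m)%N,
  (fun i => match fintype.split i with inl j => a * c j | inr j => d j end),
  (fun i => match fintype.split i with inl j => v j | inr j => w j end); split.
  by move=> i; case: fintype.split.
rewrite big_split_ord /= scaler_sumr; congr (_ + _); apply: eq_bigr => i _.
  by rewrite (unsplitK (inl i)) scalerA.
by rewrite (unsplitK (inr i)).
Qed.

End Subspaces.

Section InnerProduct.
Variables (R : realType) (X : normedModType R) (dot : {dot X for (@idfun R)}).
Hypothesis dot_norm : forall x : X, `|x| ^+ 2 = dot x x.
Implicit Types (u v : nat -> X) (x y : X).

Lemma dotC x y : dot x y = dot y x.
Proof. by rewrite hermC expr0 mul1r. Qed.

Lemma dotDl x y z : dot (x + y) z = dot x z + dot y z.
Proof. by rewrite linearDl. Qed.

Lemma dotBl x y z : dot (x - y) z = dot x z - dot y z.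
Proof. by rewrite linearBl. Qed.

Lemma dotZl a x z : dot (a *: x) z = a * dot x z.
Proof. by rewrite linearZl_LR. Qed.

Lemma dot0l z : dot 0 z = 0.
Proof. by rewrite -(scale0r (0 : X)) dotZl mul0r. Qed.

Lemma dot_suml (I : Type) (r : seq I) (P : pred I) (f : I -> X) z :
  dot (\sum_(i <- r | P i) f i) z = \sum_(i <- r | P i) dot (f i) z.
Proof. by elim/big_rec2: _ => [|i y x _ <-]; rewrite ?dot0l ?dotDl. Qed.

Definition orthoseq u := (forall i j, i != j -> dot (u i) (u j) = 0) /\
  forall i, dot (u i) (u i) = 1 \/ u i = 0.

(** For an [orthoseq] this is the orthogonal projection onto the span of the first [n] terms. *)
Definition proj u n x := \sum_(i < n) dot x (u i) *: u i.

Lemma projS u n x : proj u n.+1 x = proj u n x + dot x (u n) *: u n.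
Proof. exact: big_ord_recr. Qed.

Lemma proj_lin u n a x y : proj u n (a *: x + y) = a *: proj u n x + proj u n y.
Proof.
rewrite scaler_sumr -big_split; apply: eq_bigr => i _ /=.
by rewrite dotDl dotZl scalerDl scalerA.
Qed.

Lemma projB u n x y : proj u n (x - y) = proj u n x - proj u n y.
Proof. by rewrite addrC -scaleN1r proj_lin scaleN1r addrC. Qed.

Lemma proj0 u n : proj u n 0 = 0.
Proof. by rewrite /proj big1 // => i _; rewrite dot0l scale0r. Qed.

Lemma dot_projC u n x y : dot (proj u n x) y = dot x (proj u n y).
Proof.
rewrite [RHS]dotC !dot_suml; apply: eq_bigr => i _.
by rewrite !dotZl mulrC [dot (u i) y]dotC [dot (u i) x]dotC.
Qed.

Lemma subspace_proj_fixed u n : lin_subspace [set x | x = proj u n x].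
Proof. by split=> /= [|a x y xE yE]; rewrite ?proj0 // proj_lin -xE -yE. Qed.

Section Orthoseq.
Variables (u : nat -> X) (ou : orthoseq u).

Lemma dot_proj n x i : (i < n)%N -> dot (proj u n x) (u i) = dot x (u i).
Proof.
move=> ni; rewrite dot_suml (bigD1 (Ordinal ni)) //= big1 => [|j /eqP ij].
  rewrite addr0 dotZl; case: (ou.2 i) => ->; rewrite ?mulr1 //.
  by rewrite ![dot _ 0]dotC !dot0l mul0r.
by rewrite dotZl ou.1 ?mulr0 //; apply/eqP => ji; apply: ij; exact/val_inj.
Qed.

Lemma dot_proj_ge n x i : (n <= i)%N -> dot (proj u n x) (u i) = 0.
Proof.
move=> ni; rewrite dot_suml big1 // => j _; rewrite dotZl ou.1 ?mulr0 //.
by rewrite neq_ltn (leq_trans _ ni).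
Qed.

Lemma proj_fixed_mem n i : (i < n)%N -> u i = proj u n (u i).
Proof.
move=> ni; rewrite /proj (bigD1 (Ordinal ni)) //= big1 => [|j /eqP ij].
  by rewrite addr0; case: (ou.2 i) => ->; rewrite ?scale1r // scaler0.
by rewrite ou.1 ?scale0r //; apply/eqP => ji; apply: ij; exact/val_inj.
Qed.

Lemma proj_proj k n x : (k <= n)%N -> proj u n (proj u k x) = proj u k x.
Proof.
move=> kn; suff : [set y | y = proj u n y] (proj u k x) by move=> /= <-.
apply: (subspace_sum _ (subspace_proj_fixed u n)) => i _.
apply: (subspaceZ _ (subspace_proj_fixed u n)).
by apply: proj_fixed_mem; exact: leq_trans kn.
Qed.

Lemma norm_proj_sqr n x : `|proj u n x| ^+ 2 = \sum_(i < n) dot x (u i) ^+ 2.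
Proof.
rewrite dot_norm {1}/proj dot_suml; apply: eq_bigr => i _.
by rewrite dotZl [dot (u i) _]dotC dot_proj.
Qed.

Lemma pythagoras n x :
  `|x| ^+ 2 = `|proj u n x| ^+ 2 + `|x - proj u n x| ^+ 2.
Proof.
rewrite !dot_norm dotBl ![dot _ (x - _)]dotC !dotBl dot_projC.
rewrite proj_proj // [dot (proj _ _ _) x]dotC.
by ring.
Qed.

Lemma norm_proj_le n x : `|proj u n x| <= `|x|.
Proof.
rewrite -(@ler_pXn2r _ 2) ?nnegrE //.
by rewrite (pythagoras n x) lerDl sqr_ge0.
Qed.

Lemma norm_proj_compl_le n x : `|x - proj u n x| <= `|x|.
Proof.
rewrite -(@ler_pXn2r _ 2) ?nnegrE //.
by rewrite (pythagoras n x) lerDr sqr_ge0.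
Qed.

Lemma proj_best_approx n x y :
  y = proj u n y -> `|x - proj u n x| <= `|x - y|.
Proof.
move=> yE; have := norm_proj_compl_le n (x - y).
by rewrite projB -yE opprB addrA addrNK.
Qed.

End Orthoseq.

Lemma orthoseq_shift u k : orthoseq u -> orthoseq (fun i => u (k + i)%N).
Proof. by case=> o n; split=> // i j ij; apply: o; rewrite eqn_add2l. Qed.

(** * Gram-Schmidt orthonormalization *)

Fixpoint gram_schmidt_seq v n : seq X :=
  if n is n'.+1 then
    let s := gram_schmidt_seq v n' in
    let r := v n' - \sum_(x <- s) dot (v n') x *: x in
    rcons s (`|r|^-1 *: r)
  else [::].

(** If [v n] depends on the earlier vectors, then [r] is 0 and so is the output. *)
Definition gram_schmidt v n :=
  let r := v n - \sum_(x <- gram_schmidt_seq v n) dot (v n) x *: x in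
  `|r|^-1 *: r.

Lemma gram_schmidtE v n : let r := v n - proj (gram_schmidt v) n (v n) in
  gram_schmidt v n = `|r|^-1 *: r.
Proof.
have seqE k : gram_schmidt_seq v k = mkseq (gram_schmidt v) k.
  by elim: k => //= k IH; rewrite mkseqS -IH.
rewrite /= {1 2}/gram_schmidt seqE big_map -[X in iota 0 X](subn0 n).
by rewrite -/(index_iota 0 n) big_mkord.
Qed.

Lemma gram_schmidt_unit v n : dot (gram_schmidt v n) (gram_schmidt v n) = 1 \/
  gram_schmidt v n = 0.
Proof.
rewrite gram_schmidtE; set r := _ - _; have [->|r0] := eqVneq r 0.
  by right; rewrite scaler0.
left; rewrite dotZl dotC dotZl -dot_norm mulrA -expr2 -exprMn mulVf ?expr1n //.
by rewrite normr_eq0.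
Qed.

Lemma gram_schmidt_orthoseq v : orthoseq (gram_schmidt v).
Proof.
suff lt_ortho n : forall i j, (i < j)%N -> (j < n)%N ->
    dot (gram_schmidt v i) (gram_schmidt v j) = 0.
  split=> [i j|i]; last exact: gram_schmidt_unit.
  rewrite neq_ltn => /orP[ij|ji]; first exact: (lt_ortho j.+1).
  by rewrite dotC; exact: (lt_ortho i.+1).
elim: n => // n IH i j ij; rewrite ltnS leq_eqVlt => /predU1P[jn|]; last exact: IH.
subst j.
(* Cut off by zeros from index [n] on, the sequence is a full [orthoseq] by induction, so the
   projection lemmas apply to it and make the residual of [v n] orthogonal to the earlier terms. *)
set u := gram_schmidt v in IH *; set u' := fun k => if (k < n)%N then u k else 0.
have ou' : orthoseq u'.
  split=> [k l kl|k]; rewrite /u'.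
    case: ifP => kn; case: ifP => ln; rewrite ?dot0l // ?[dot _ 0]dotC ?dot0l //.
    move: kl; rewrite neq_ltn => /orP[kl|lk]; first exact: IH.
    by rewrite dotC; exact: IH.
  by case: ifP => _; [exact: gram_schmidt_unit | right].
have projE x : proj u n x = proj u' n x.
  by apply: eq_bigr => k _; rewrite /u' ltn_ord.
rewrite dotC [u n]gram_schmidtE dotZl dotBl -/u projE.
have -> : u i = u' i by rewrite /u' ij.
by rewrite dot_proj // subrr mulr0.
Qed.

(** The coordinate of [v n] along the new vector is the norm of the residual [r], so the last term
    of the projection restores [r]; this also covers [r = 0]. *)
Lemma gram_schmidt_proj v n : v n = proj (gram_schmidt v) n.+1 (v n).
Proof.
set u := gram_schmidt v; set r := v n - proj u n (v n).
have uE : u n = `|r|^-1 *: r by rewrite [u n]gram_schmidtE.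
have vu : dot (v n) (u n) = dot r (u n).
  by rewrite dotBl dot_proj_ge ?subr0 //; exact: gram_schmidt_orthoseq.
rewrite projS vu uE dotC dotZl -dot_norm scalerA.
have [r0|r0] := eqVneq r 0.
  by rewrite r0 scaler0 addr0; apply/eqP; rewrite -subr_eq0 -/r r0.
rewrite expr2 mulrCA mulrA divff ?normr_eq0 // mul1r mulfV ?normr_eq0 // scale1r.
by rewrite addrC subrK.
Qed.

Lemma gram_schmidt_sub v (B : set X) n : lin_subspace B ->
  (forall i, (i <= n)%N -> B (v i)) -> B (gram_schmidt v n).
Proof.
move=> sB; elim/ltn_ind: n => n IH Bv.
rewrite gram_schmidtE; apply: subspaceZ => //; apply: subspaceB => //.
  exact: Bv.
apply: subspace_sum => // i _; apply: subspaceZ => //; apply: IH => // j ji.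
by apply: Bv; exact: leq_trans ji (ltnW _).
Qed.

Lemma dot_proj_compl u n x : orthoseq u ->
  forall i, (n <= i)%N -> dot (x - proj u n x) (u i) = dot x (u i).
Proof. by move=> ou i ni; rewrite dotBl dot_proj_ge ?subr0. Qed.

(* [A] is the triangular matrix of coordinates of the [phi (k + i)] along the
   [u (k + j)], and [V] collects coordinates of an orthonormal basis of the
   projection of the span of [w] to the span of these [u (k + j)]. *)
Lemma prod_diag_coord_le u (phi : nat -> X) (k m : nat) (w : 'I_m -> X)
    (tau delta : R) : orthoseq u ->
  (forall i, (k <= i)%N -> phi i = proj u i.+1 (phi i)) ->
  0 < delta <= tau ->
  (forall i, (i < m + m)%N -> `|phi (k + i)%N - proj u k (phi (k + i)%N)| <= tau) ->
  (forall i, (i < m + m)%N ->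
     exists2 p, lspan (range w) p & `|phi (k + i)%N - p| <= delta) ->
  \prod_(i < m + m) dot (phi (k + i)%N) (u (k + i)%N) ^+ 2 <=
    (2 * tau * delta) ^+ (m + m).
Proof.
move=> ou phiE dt phi_tau phi_w; set n := (m + m)%N.
pose u' j := u (k + j)%N; have ou' : orthoseq u' by exact: orthoseq_shift.
(* The finite family of projected [w i] is padded with zeros to a sequence, the input format of
   [gram_schmidt]. *)
pose w' j := if insub j is Some i then proj u' n (w i) else 0.
pose t := gram_schmidt w'; have ot : orthoseq t by exact: gram_schmidt_orthoseq.
have tE j : t j = proj u' n (t j).
  apply: (gram_schmidt_sub (subspace_proj_fixed u' n)) => i _.
  by rewrite /w'; case: insub => [i'|] /=; rewrite ?proj0 // proj_proj.
pose A : 'M[R]_n := \matrix_(i, j) dot (phi (k + i)%N) (u' j).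
pose V : 'M[R]_(m, n) := \matrix_(i, j) dot (t i) (u' j).
have VVE i j : (V *m V^T) i j = dot (t i) (t j).
  rewrite mxE [in RHS](tE j) [RHS]dotC dot_suml; apply: eq_bigr => l _.
  by rewrite !mxE [RHS]dotZl mulrC; congr (_ * _); exact: dotC.
have dV : is_diag_mx (V *m V^T).
  by apply/is_diag_mxP => i j ij; rewrite VVE ot.1.
have V1 i : (V *m V^T) i i <= 1.
  by rewrite VVE; case: (ot.2 i) => ->; rewrite ?dot0l.
have normA i : (row i A *m (row i A)^T) 0 0 = `|proj u' n (phi (k + i)%N)| ^+ 2.
  rewrite (norm_proj_sqr ou') mxE; apply: eq_bigr => j _.
  by rewrite !mxE expr2.
have normAV i : ((row i A *m V^T) *m (row i A *m V^T)^T) 0 0 =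
    `|proj t m (phi (k + i)%N)| ^+ 2.
  rewrite (norm_proj_sqr ot) mxE; apply: eq_bigr => j _.
  rewrite [_^T _ _]mxE -expr2; congr (_ ^+ 2).
  rewrite mxE [in RHS](tE j) [RHS]dotC dot_suml; apply: eq_bigr => l _.
  by rewrite !mxE [RHS]dotZl mulrC; congr (_ * _); exact: dotC.
have tA : is_trig_mx A.
  apply/is_trig_mxP => i j ij; rewrite mxE phiE ?leq_addr //.
  by rewrite dot_proj_ge // -addnS leq_add2l.
have -> : \prod_(i < n) dot (phi (k + i)%N) (u (k + i)%N) ^+ 2 = (\det A) ^+ 2.
  by rewrite det_trig // -prodrXl; apply: eq_bigr => i _; rewrite mxE.
apply: (det_sqr_le (V := V)) => // i; rewrite normA.
  rewrite lerXn2r ?nnegrE //; first by case/andP: dt => /ltW/le_trans; apply.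
  (* Removing the part along the first [k] vectors leaves the coordinates along [u'] unchanged, so
     the row norm is at most the distance bounded by [tau]. *)
  apply: le_trans (phi_tau i (ltn_ord i)).
  have := norm_proj_le ou' n (phi (k + i)%N - proj u k (phi (k + i)%N)).
  congr (`|_| <= _); apply: eq_bigr => j _.
  by rewrite dot_proj_compl // leq_addr.
rewrite normAV; have [p wp ple] := phi_w i (ltn_ord i).
have projtE x : proj t m (proj u' n x) = proj t m x.
  by apply: eq_bigr => j _; rewrite dot_projC -tE.
(* The projection of [p] lies in the span of the first [m] vectors of [t], so it competes with the
   best approximation there, at distance at most [delta]. *)
have wE : proj u' n p = proj t m (proj u' n p).
  apply: (lspan_min (B := [set x | proj u' n x = proj t m (proj u' n x)])) wp.
    split=> /= [|a x y xE yE]; first by rewrite !proj0.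
    by rewrite !proj_lin -xE -yE.
  move=> _ [j _ <-] /=; have -> : proj u' n (w j) = w' j by rewrite /w' valK.
  have wjE := gram_schmidt_proj w' j.
  by rewrite [in RHS]wjE proj_proj // -wjE.
rewrite (pythagoras ot m (proj u' n _)) projtE lerD2l -projtE.
rewrite lerXn2r ?nnegrE //; first by case/andP: dt => /ltW.
apply: le_trans (proj_best_approx ot _ wE) _.
by rewrite -projB; apply: le_trans ple; exact: norm_proj_le.
Qed.

End InnerProduct.

(** * Interpolation operators *)

Lemma geim_space_min (R : realType) (X : completeNormedModType R) (phi : nat -> X)
    n (B : set X) : lin_subspace B -> (forall i, (i < n)%N -> B (phi i)) ->
  geim_space phi n `<=` B.
Proof.
move=> sB Bphi; have phiB : phi @` `I_n `<=` B by move=> _ [i /= ni <-]; exact: Bphi.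
exact: (lspan_min sB phiB).
Qed.

Lemma geim_space_mem (R : realType) (X : completeNormedModType R) (phi : nat -> X)
    n i : (i < n)%N -> geim_space phi n (phi i).
Proof. by move=> ni; apply: sub_lspan; exists i. Qed.

Lemma geim_space_leq (R : realType) (X : completeNormedModType R) (phi : nat -> X)
    m n : (m <= n)%N -> geim_space phi m `<=` geim_space phi n.
Proof.
move=> mn; apply: geim_space_min; first exact: subspace_lspan.
by move=> i im; apply: geim_space_mem; exact: leq_trans mn.
Qed.

Lemma geim_spaceS (R : realType) (X : completeNormedModType R) (phi : nat -> X)
    n v : geim_space phi n.+1 v ->
  exists2 p, geim_space phi n p & exists c, v = p + c *: phi n.
Proof.
have sX : lin_subspace (geim_space phi n) by exact: subspace_lspan.
apply: (geim_space_min (B := [set v | exists2 p, geim_space phi n p &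
    exists c, v = p + c *: phi n])).
  split=> [|a _ _ [p Xp [c ->]] [q Xq [d ->]]] /=.
    by exists 0; [exact: sX.1 | exists 0; rewrite scale0r addr0].
  exists (a *: p + q); first exact: sX.2.
  by exists (a * c + d); rewrite scalerDr scalerDl scalerA addrACA.
move=> i; rewrite ltnS leq_eqVlt => /predU1P[->|ni] /=.
  by exists 0; [exact: sX.1 | exists 1; rewrite scale1r add0r].
by exists (phi i); [exact: geim_space_mem | exists 0; rewrite scale0r addr0].
Qed.

Lemma continuous_functional_bound (R : realType) (X : normedModType R)
    (s : {linear X -> R^o}) : continuous s ->
  exists2 C, 0 < C & forall x, `|s x| <= C * `|x|.
Proof.
move=> /(_ 0) /(continuous_linear_bounded 0) /linear_boundedP.
by move=> /pinfty_ex_gt0[C C0 sC]; exists C.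
Qed.

Section Interpolation.
Variables (R : realType) (X : completeNormedModType R).
Variables (phi : nat -> X) (sigma : nat -> {linear X -> R^o}).
Let J := geim_interp phi sigma.
Let Lambda := lebesgue_const phi sigma.

(** Unisolvence together with a norm bound. Carrying the bound through the induction is what makes
    the Lebesgue constant a genuine supremum, as [sup] of an unbounded set is 0. *)
Definition interp_wellposed n :=
  (forall v, geim_space phi n v -> (forall i, (i < n)%N -> sigma i v = 0) -> v = 0)
  /\ exists C, forall f, exists v, [/\ geim_space phi n v,
       forall i, (i < n)%N -> sigma i v = sigma i f & `|v| <= C * `|f|].

Section Wellposed.
Variables (n : nat) (wn : interp_wellposed n).

Lemma interp_unique v w : geim_space phi n v -> geim_space phi n w ->
  (forall i, (i < n)%N -> sigma i v = sigma i w) -> v = w.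
Proof.
move=> Xv Xw vw; apply/eqP; rewrite -subr_eq0; apply/eqP/wn.1.
  by apply: subspaceB => //; exact: subspace_lspan.
by move=> i ni; rewrite linearB vw //= subrr.
Qed.

Lemma interpP f : geim_space phi n (J n f) /\
  forall i, (i < n)%N -> sigma i (J n f) = sigma i f.
Proof.
have [C /(_ f)[v [Xv vf _]]] := wn.2.
apply: (xgetPex 0 (P := [set v | geim_space phi n v /\
  forall i, (i < n)%N -> sigma i v = sigma i f])).
by exists v.
Qed.

Lemma interpE f v : geim_space phi n v ->
  (forall i, (i < n)%N -> sigma i v = sigma i f) -> J n f = v.
Proof.
move=> Xv vf; have [XJ Jf] := interpP f.
by apply: interp_unique => // i ni; rewrite Jf // vf.
Qed.

Lemma interp_bounded : exists C, forall f, `|J n f| <= C * `|f|.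
Proof.
have [C CP] := wn.2; exists C => f; have [v [Xv vf vC]] := CP f.
by rewrite (interpE Xv vf).
Qed.

Lemma interp_sub f p : geim_space phi n p -> J n (f - p) = J n f - p.
Proof.
move=> Xp; have [XJ Jf] := interpP f; apply: interpE.
  by apply: subspaceB => //; exact: subspace_lspan.
by move=> i ni; rewrite !linearB /= Jf.
Qed.

Lemma norm_interp_le f : `|J n f| <= Lambda n * `|f|.
Proof.
have [C CP] := interp_bounded.
have [->|f0] := eqVneq f 0.
  by apply: le_trans (CP 0) _; rewrite normr0 !mulr0.
rewrite -ler_pdivrMr ?normr_gt0 //; apply: ub_le_sup.
  by exists C => _ [x /= x0 <-]; rewrite ler_pdivrMr ?normr_gt0.
by exists f.
Qed.

Lemma lebesgue_const_ge0 : 0 <= Lambda n.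
Proof.
have [[f f0]|nf] := pselect (exists f : X, f != 0).
  by have := le_trans (normr_ge0 _) (norm_interp_le f); rewrite pmulr_lge0 ?normr_gt0.
(* In the zero space the set of ratios is empty and its [sup] is 0. *)
rewrite /Lambda /lebesgue_const /opnorm (_ : [set _ | _ in _] = set0) ?sup0 //.
by apply/seteqP; split=> // y [f f0 _]; apply: nf; exists f.
Qed.

(** Interpolation fixes [p], so the error of [f] equals the error of [f - p]. *)
Lemma interp_quasi_optimal f p :
  geim_space phi n p -> `|f - J n f| <= (1 + Lambda n) * `|f - p|.
Proof.
move=> Xp; have -> : f - J n f = (f - p) - J n (f - p).
  by rewrite interp_sub // opprB addrA subrK.
by rewrite (le_trans (ler_normB _ _)) // mulrDl mul1r lerD2l norm_interp_le.
Qed.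

(** The residual [e] is killed by the earlier functionals but not by [sigma n]. Taking it as the new
    basis vector makes the system triangular: the new interpolant is the old one plus a multiple of
    [e] fixed by [sigma n]. *)
Lemma interp_wellposedS : continuous (sigma n) ->
  sigma n (phi n - J n (phi n)) != 0 -> interp_wellposed n.+1.
Proof.
move=> cs; set e := phi n - _ => se.
have sX k : lin_subspace (geim_space phi k) by exact: subspace_lspan.
have [XJ Jphi] := interpP (phi n).
have se0 i : (i < n)%N -> sigma i e = 0.
  by move=> ni; rewrite /e linearB /= Jphi // subrr.
split=> [v /geim_spaceS[p Xp [c vE]] sv|].
  have {}vE : v = (p + c *: J n (phi n)) + c *: e.
    by rewrite vE /e -addrA -scalerDr [J n _ + _]addrC subrK.
  have q0 : p + c *: J n (phi n) = 0.
    apply: wn.1 => [|i ni]; first by apply: subspaceD => //; exact: subspaceZ.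
    have := sv i (ltnW ni); rewrite vE linearD linearZ /= se0 // scaler0.
    by rewrite addr0.
  move: vE; rewrite q0 add0r => vE.
  have /eqP := sv n (ltnSn n); rewrite vE linearZ /= mulf_eq0 (negbTE se) orbF.
  by move=> /eqP ->; rewrite scale0r.
have [C JC] := interp_bounded.
have [D D0 sD] := continuous_functional_bound cs.
exists (C + D * (1 + C) / `|sigma n e| * `|e|) => f.
have [XJf Jf] := interpP f.
have sigmaD i x c : sigma i (x + c *: e) = sigma i x + c * sigma i e.
  by rewrite linearD linearZ.
exists (J n f + (sigma n (f - J n f) / sigma n e) *: e); split.
- apply: subspaceD => //; first exact: geim_space_leq XJf.
  apply: subspaceZ => //; apply: subspaceB => //.
    exact: geim_space_mem.
  exact: geim_space_leq XJ.
- move=> i; rewrite ltnS leq_eqVlt => /predU1P[->|ni].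
    by rewrite sigmaD divfK // linearB /= addrC subrK.
  by rewrite sigmaD (se0 i) // mulr0 addr0 Jf.
- rewrite (le_trans (ler_normD _ _)) // mulrDl lerD ?JC //.
  rewrite normrZ normrM normfV.
  have : `|sigma n (f - J n f)| <= D * (1 + C) * `|f|.
    apply: le_trans (sD _) _; rewrite -mulrA ler_pM2l //.
    by rewrite (le_trans (ler_normB _ _)) // mulrDl mul1r lerD2l JC.
  have -> : D * (1 + C) / `|sigma n e| * `|e| * `|f| =
      D * (1 + C) * `|f| / `|sigma n e| * `|e| by ring.
  by move=> h; rewrite !ler_wpM2r ?invr_ge0.
Qed.

End Wellposed.

Lemma interp_wellposed0 : interp_wellposed 0.
Proof.
have X0 v : geim_space phi 0 v -> v = 0.
  apply: (geim_space_min (B := [set 0])) => //; split=> // a x y -> ->.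
  by rewrite scaler0 addr0.
split=> [v /X0//|]; exists 0 => f; exists 0; split=> //; last first.
  by rewrite normr0 mul0r.
by have [] := subspace_lspan (phi @` `I_0).
Qed.

(** This makes the initial choice of [phi 0] and [sigma 0] an instance of the general greedy
    step. *)
Lemma interp0 f : J 0 f = 0.
Proof.
apply: interpE => //; first exact: interp_wellposed0.
by have [] := subspace_lspan (phi @` `I_0).
Qed.

End Interpolation.

(** * Greedy runs *)

Lemma kolmogorov_width_lt (R : realType) (X : normedModType R) (F : set X) n d :
  F !=set0 -> (forall f, F f -> `|f| <= 1) -> kolmogorov_width F n < d ->
  exists w : 'I_n -> X, forall f, F f ->
    exists2 p, lspan (range w) p & `|f - p| < d.
Proof.
move=> F0 F1 /inf_lt[].
  (* The zero space shows that the infimum is over a nonempty set. *)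
  pose Y : set X := lspan (range (fun _ : 'I_n => 0)).
  by exists (sup [set inf [set `|u - v| | v in Y] | u in F]), Y => //; exists (fun=> 0).
move=> _ [_ [w ->] <-] supd; exists w => f Ff.
have dist_le g p : lspan (range w) p ->
    inf [set `|g - v| | v in lspan (range w)] <= `|g - p|.
  by move=> wp; apply: ge_inf; [exists 0 => _ [v _ <-] | exists p].
have /inf_lt[|_ [p wp <-] fp] : inf [set `|f - v| | v in lspan (range w)] < d.
  apply: le_lt_trans supd; apply: ub_le_sup; last by exists f.
  exists 1 => _ [g Fg <-].
  apply: le_trans (dist_le g 0 (subspace_lspan _).1) _.
  by rewrite subr0 F1.
- by exists `|f - 0|; exists 0 => //; exact: (subspace_lspan _).1.
- by exists p.
Qed.

Section Run.
Variables (R : realType) (X : completeNormedModType R).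
Variables (dot : {dot X for (@idfun R)}).
Hypothesis dot_norm : forall x : X, `|x| ^+ 2 = dot x x.
Variables (F : set X) (N : option nat) (Sigma : set {linear X -> R^o}).
Variables (eta : R) (Fs : nat -> set X) (Ss : nat -> set {linear X -> R^o}).
Variables (phi : nat -> X) (sigma : nat -> {linear X -> R^o}).
Hypothesis setting : geim_setting F N Sigma.
Hypothesis run : geim_run F N Sigma eta Fs Ss phi sigma.
Let J := geim_interp phi sigma.
Let Lambda := lebesgue_const phi sigma.
Let gamma n := eta / (1 + Lambda n).
Let u := gram_schmidt dot phi.
Let P := proj dot u.

Lemma index_leW m n : (m <= n)%N -> index_le n N -> index_le m N.
Proof. by case: N => //= k; exact: leq_trans. Qed.

Lemma run_eta_gt0 : 0 < eta.
Proof. by case/andP: (geim_eta run). Qed.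

Lemma run_phi_argmax n : index_le n N ->
  is_argmax (Fs n) (fun f => `|f - J n f|) (phi n).
Proof.
case: n => [_|n nN]; last by apply: geim_phi run _ _ nN.
have [? h] := geim_phi0 run; split=> // f Ff.
by rewrite /= /J !interp0 !subr0; exact: h.
Qed.

Lemma run_sigma_argmax n : index_le n N ->
  is_argmax (Ss n) (fun s : {linear X -> R^o} => `|s (phi n - J n (phi n))|)
    (sigma n).
Proof.
case: n => [_|n nN]; last by apply: geim_sigma run _ _ nN.
have [? h] := geim_sigma0 run; split=> // s Ss0.
by rewrite /= /J !interp0 !subr0; exact: h.
Qed.

Lemma run_weak n : index_le n N ->
  eta * sup [set `|f - J n f| | f in F] <= sup [set `|f - J n f| | f in Fs n].
Proof.
case: n => [_|n nN]; last by apply: geim_weak run _ _ nN.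
have E (A : set X) : [set `|f - J 0 f| | f in A] = [set `|f| | f in A].
  by apply/eq_imagel => f _; rewrite /J interp0 subr0.
by rewrite !E; exact: geim_weak0 run.
Qed.

Lemma run_Fs_leq m n : (m <= n)%N -> index_le n N -> Fs m `<=` Fs n.
Proof.
elim: n => [|n IH]; first by rewrite leqn0 => /eqP -> _ x.
rewrite leq_eqVlt => /predU1P[-> _ x|mn nN] //.
apply: subset_trans (IH mn (index_leW (leqnSn n) nN)) _.
exact: (geim_Fs_incr run nN).
Qed.

Lemma run_phi_Fs m n : (m <= n)%N -> index_le n N -> Fs n (phi m).
Proof.
move=> mn nN; apply: (run_Fs_leq mn nN).
by have [] := run_phi_argmax (index_leW mn nN).
Qed.

Lemma run_phi_F n : index_le n N -> F (phi n).
Proof. by move=> nN; apply: (geim_Fs_sub run nN); exact: run_phi_Fs. Qed.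

Lemma run_greedy n f : interp_wellposed phi sigma n -> index_le n N -> F f ->
  eta * `|f - J n f| <= `|phi n - J n (phi n)|.
Proof.
move=> wn nN Ff; have [Fphi phi_max] := run_phi_argmax nN.
have : sup [set `|f - J n f| | f in Fs n] <= `|phi n - J n (phi n)|.
  apply: ge_sup; first by exists `|phi n - J n (phi n)|, (phi n).
  by move=> _ [g Fg <-]; exact: phi_max.
apply: le_trans; apply: le_trans (run_weak nN).
rewrite ler_pM2l ?run_eta_gt0 //; apply: ub_le_sup; last by exists f.
(* The errors over [F] are bounded, so their [sup] is indeed an upper bound. *)
exists (1 + Lambda n) => _ [g Fg <-].
apply: le_trans (ler_normB _ _) _; apply: lerD; first exact: (geim_norm_le1 setting Fg).
apply: le_trans (norm_interp_le wn g) _.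
by rewrite ler_piMr ?(lebesgue_const_ge0 wn) // (geim_norm_le1 setting).
Qed.

(** A zero residual would, by the greedy choice, put all of [F] into [X_n], against the assumption
    on the dimension of the span of [F]. *)
Lemma run_residual_neq0 n : interp_wellposed phi sigma n -> index_le n N ->
  phi n - J n (phi n) != 0.
Proof.
move=> wn nN; apply/eqP => e0; apply: (geim_dim setting nN).
exists (fun i : 'I_n => phi i).
have -> : range (fun i : 'I_n => phi i) = phi @` `I_n.
  apply/seteqP; split=> _ [i /= h <-]; first by exists i => /=.
  by exists (Ordinal h).
apply/seteqP; split.
  apply: (lspan_min (subspace_lspan (phi @` `I_n))) => f Ff.
  have := run_greedy wn nN Ff; rewrite e0 normr0 pmulr_rle0 ?run_eta_gt0 //.
  rewrite normr_le0 subr_eq0 => /eqP ->.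
  by have [] := interpP wn f.
apply: (lspan_min (subspace_lspan F)) => _ [i /= ni <-].
by apply: sub_lspan; apply: run_phi_F; exact: index_leW (ltnW ni) nN.
Qed.

Lemma run_wellposed n : index_le n N -> interp_wellposed phi sigma n.
Proof.
elim: n => [_|n IH nN]; first exact: interp_wellposed0.
have nN' := index_leW (leqnSn n) nN; have wn := IH nN'.
have [Ssigma sigma_max] := run_sigma_argmax nN'.
apply: interp_wellposedS => //.
  by have [] := geim_P1 setting (geim_Ss_sub run nN' Ssigma).
(* If the maximizing functional vanished on the residual, so would all of [Ss n]; the residual lies
   in the span of [Fs n], so (P2) would make it 0. *)
apply: contra_neq (run_residual_neq0 wn nN') => s0.
apply: (geim_Ss_P2 run nN').
  apply: subspaceB; first exact: subspace_lspan.
    exact/sub_lspan/run_phi_Fs.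
  apply: (geim_space_min (phi := phi) (n := n) (subspace_lspan _)) => [i ni|].
    by apply: sub_lspan; exact: run_phi_Fs (ltnW ni) nN'.
  by have [] := interpP wn (phi n).
move=> s Sss; apply/eqP; rewrite -normr_le0.
by have := sigma_max s Sss; rewrite /= s0 normr0.
Qed.

(** * Orthogonal projection onto the greedy spaces *)

Lemma phi_proj n m : (n < m)%N -> phi n = P m (phi n).
Proof.
move=> nm; rewrite [in RHS](gram_schmidt_proj dot_norm phi n) /P.
rewrite proj_proj //; first exact: gram_schmidt_proj.
exact: gram_schmidt_orthoseq.
Qed.

Lemma geim_space_proj_mem n f : geim_space phi n (P n f).
Proof.
apply: subspace_sum => [|i _]; first exact: subspace_lspan.
apply: subspaceZ; first exact: subspace_lspan.
apply: gram_schmidt_sub => [|j ji]; first exact: subspace_lspan.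
by apply: geim_space_mem; exact: leq_ltn_trans (ltn_ord i).
Qed.

Lemma geim_space_proj_fixed n p : geim_space phi n p -> p = P n p.
Proof.
apply: (geim_space_min (B := [set x | x = P n x])); first exact: subspace_proj_fixed.
by move=> i ni; exact: phi_proj.
Qed.

Lemma run_quasi_optimal n f : index_le n N ->
  `|f - J n f| <= (1 + Lambda n) * `|f - P n f|.
Proof.
move=> /run_wellposed wn; apply: interp_quasi_optimal => //.
exact: geim_space_proj_mem.
Qed.

Lemma run_proj_best n f p : geim_space phi n p -> `|f - P n f| <= `|f - p|.
Proof.
move=> /geim_space_proj_fixed; apply: proj_best_approx => //.
exact: gram_schmidt_orthoseq.
Qed.

Lemma gamma_gt0 n : index_le n N -> 0 < gamma n.
Proof.
move=> /run_wellposed wn; rewrite divr_gt0 ?run_eta_gt0 //.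
by rewrite ltr_pwDl // (lebesgue_const_ge0 wn).
Qed.

Lemma norm_dot_phi n : `|dot (phi n) (u n)| = `|phi n - P n (phi n)|.
Proof.
rewrite [X in X - _](phi_proj (ltnSn n)) /P projS addrAC subrr add0r normrZ.
have [_ /(_ n)[un|un]] := gram_schmidt_orthoseq dot_norm phi.
  have -> : `|u n| = 1; last by rewrite mulr1.
  by apply/eqP; rewrite -(@eqrXn2 _ 2) // expr1n dot_norm; exact/eqP.
by rewrite /u un normr0 mulr0 dotC dot0l normr0.
Qed.

(** Chain: distance of [f] to [X_n], interpolation error of [f], that of [phi n] at the cost of
    [eta], and distance of [phi n] to [X_n] at the cost of [1 + Lambda n]. *)
Lemma run_gamma_le n f : index_le n N -> F f ->
  gamma n * `|f - P n f| <= `|dot (phi n) (u n)|.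
Proof.
move=> nN Ff; have wn := run_wellposed nN.
have L0 : 0 < 1 + Lambda n by rewrite ltr_pwDl // (lebesgue_const_ge0 wn).
rewrite /gamma mulrAC ler_pdivrMr //.
have [XJ _] := interpP wn f.
apply: (@le_trans _ _ (eta * `|f - J n f|)).
  by rewrite ler_pM2l ?run_eta_gt0 //; exact: run_proj_best.
apply: le_trans (run_greedy wn nN Ff) _.
apply: le_trans (run_quasi_optimal _ nN) _.
by rewrite mulrC ler_pM2r // norm_dot_phi.
Qed.

(** The quantity [tau_n]: [P n] projects orthogonally onto [X_n]. *)
Definition max_error n := sup [set `|f - P n f| | f in F].

Lemma error_le_max n f : F f -> `|f - P n f| <= max_error n.
Proof.
move=> Ff; apply: ub_le_sup; last by exists f.
exists 1 => _ [g Fg <-]; apply: le_trans (geim_norm_le1 setting Fg).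
by apply: norm_proj_compl_le => //; exact: gram_schmidt_orthoseq.
Qed.

Lemma F_neq0 : F !=set0.
Proof. by exists (phi 0%N); apply: run_phi_F; case: N. Qed.

Lemma max_error_le n b :
  (forall f, F f -> `|f - P n f| <= b) -> max_error n <= b.
Proof.
move=> Fb; apply: ge_sup => [|_ [f Ff <-]]; last exact: Fb.
by have [f Ff] := F_neq0; exists `|f - P n f|, f.
Qed.

Lemma max_error_ge0 n : 0 <= max_error n.
Proof. by have [f /(error_le_max n)] := F_neq0; exact: le_trans. Qed.

Lemma max_error_le1 n : max_error n <= 1.
Proof.
apply: max_error_le => f Ff; apply: le_trans (geim_norm_le1 setting Ff).
by apply: norm_proj_compl_le => //; exact: gram_schmidt_orthoseq.
Qed.

Lemma max_error_anti m n : (m <= n)%N -> max_error n <= max_error m.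
Proof.
move=> mn; apply: max_error_le => f Ff; apply: le_trans (error_le_max m Ff).
apply: run_proj_best; apply: (geim_space_leq mn); exact: geim_space_proj_mem.
Qed.

(** The last error is below every error in the block, and [gamma] times an error is below a diagonal
    entry of the coordinate matrix, whose determinant is bounded. *)
Lemma max_error_prod_le m k d : (0 < m)%N -> index_le (k + (m + m)).-1 N ->
  kolmogorov_width F m < d ->
  \prod_(i < m + m) (gamma (k + i)%N * max_error (k + m + m).-1) ^+ 2 <=
    (2 * max_error k * d) ^+ (m + m).
Proof.
move=> m0 kN dm; have [w wF] := kolmogorov_width_lt F_neq0 (geim_norm_le1 setting) dm.
have d0 : 0 < d.
  by have [f /wF[p _]] := F_neq0; exact: le_lt_trans.
set n := (m + m)%N; set tau := max_error k.
have iN (i : 'I_n) : index_le (k + i) N.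
  by apply: index_leW kN; have := ltn_ord i; rewrite /n; lia.
have lastle (i : 'I_n) : max_error (k + m + m).-1 <= max_error (k + i).
  by apply: max_error_anti; have := ltn_ord i; rewrite /n; lia.
have tau_ge0 : 0 <= tau by exact: max_error_ge0.
have ou : orthoseq dot u by exact: gram_schmidt_orthoseq.
have [tau0|tau0] := eqVneq tau 0.
  have -> : max_error (k + m + m).-1 = 0.
    apply/eqP; rewrite eq_le max_error_ge0 andbT -tau0.
    by apply: max_error_anti; lia.
  rewrite tau0 mulr0 mul0r; under eq_bigr do rewrite mulr0 expr0n /=.
  by rewrite prodr_const card_ord.
have tau_gt0 : 0 < tau by rewrite lt_def tau0.
apply: (@le_trans _ _ (\prod_(i < n) dot (phi (k + i)%N) (u (k + i)%N) ^+ 2)).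
  apply: ler_prod => i _; rewrite sqr_ge0 /= -[leRHS]real_normK ?num_real //.
  have g0 : 0 <= gamma (k + i)%N by exact/ltW/gamma_gt0.
  apply: lerXn2r; rewrite ?nnegrE ?normr_ge0 ?(mulr_ge0 g0) ?max_error_ge0 //.
  rewrite mulrC -ler_pdivlMr ?gamma_gt0 //.
  apply: le_trans (lastle i) _; apply: max_error_le => f Ff.
  by rewrite ler_pdivlMr ?gamma_gt0 // mulrC run_gamma_le.
have phiF (i : nat) : (i < n)%N -> F (phi (k + i)%N).
  by move=> ni; apply: run_phi_F; exact: iN (Ordinal ni).
(* The determinant bound requires [d <= tau]; otherwise each factor is already at most
   [tau ^+ 2 <= 2 * tau * d]. *)
have [dt|/ltW td] := leP d tau.
  apply: (@prod_diag_coord_le _ _ dot dot_norm u phi k m w) => //.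
  - by move=> i _; exact: gram_schmidt_proj.
  - by rewrite d0.
  - by move=> i ni; apply: error_le_max; exact: phiF.
  - by move=> i ni; have [p wp /ltW] := wF _ (phiF i ni); exists p.
rewrite -[X in _ ^+ X]card_ord -prodr_const; apply: ler_prod => i _.
rewrite sqr_ge0 /= -[leLHS]real_normK ?num_real // norm_dot_phi.
have : `|phi (k + i)%N - P (k + i) (phi (k + i)%N)| <= tau.
  apply: le_trans (error_le_max _ (phiF i (ltn_ord i))) _.
  by apply: max_error_anti; exact: leq_addr.
move: (normr_ge0 (phi (k + i)%N - P (k + i) (phi (k + i)%N))).
by move: `|_ - _| => e e0 et; nra.
Qed.

Lemma prod_gamma_root_gt0 k n : (forall i, (i < n)%N -> index_le (k + i)%N N) ->
  0 < \prod_(i < n) gamma (k + i)%N `^ n%:R^-1.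
Proof. by move=> kN; apply: prodr_gt0 => i _; rewrite powR_gt0 // gamma_gt0 // kN. Qed.

Lemma max_error_le_sqrt m k D : (0 < m)%N -> index_le (k + (m + m)).-1 N ->
  0 <= D -> kolmogorov_width F m <= D ->
  max_error (k + m + m).-1 <= Num.sqrt (2 * max_error k * D) *
    (\prod_(i < m + m) gamma (k + i)%N `^ (m + m)%:R^-1)^-1.
Proof.
move=> m0 kN D0 dD; set n := (m + m)%N; set tau := max_error _.
have n0 : (0 < n)%N by rewrite /n; lia.
have iN i : (i < n)%N -> index_le (k + i) N.
  by move=> ni; apply: index_leW kN; rewrite -/n; lia.
have := prod_gamma_root_gt0 iN; set G := \prod_(_ < _) _ => G0.
have tau0 : 0 <= tau by exact: max_error_ge0.
have GE : G ^+ n = \prod_(i < n) gamma (k + i)%N.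
  rewrite -prodrXl; apply: eq_bigr => i _.
  rewrite -powR_mulrn ?powR_ge0 // -powRrM mulVf ?pnatr_eq0 ?gtn_eqF //.
  by rewrite powRr1 // ltW // gamma_gt0 // iN.
rewrite ler_pdivlMr //.
have -> : tau * G = Num.sqrt ((tau * G) ^+ 2).
  by rewrite sqrtr_sqr ger0_norm // mulr_ge0 // ltW.
(* The product bound needs a number strictly above the width. The choice [D + e / 2] costs at most
   [e], since [max_error k <= 1]. *)
apply: ler_wsqrtr; apply/ler_addgt0Pr => e e0.
have de : kolmogorov_width F m < D + e / 2.
  by apply: le_lt_trans dD _; rewrite ltrDl divr_gt0.
have De0 : 0 <= D + e / 2 by rewrite addr_ge0 // divr_ge0 // ltW.
have := max_error_prod_le m0 kN de.
under eq_bigr do rewrite exprMn -/tau.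
rewrite big_split /= prodr_const card_ord prodrXl -GE [(G ^+ n) ^+ 2]exprAC.
rewrite -/n -exprMn -(exprMn 2).
rewrite ler_pXn2r ?nnegrE ?mulr_ge0 ?sqr_ge0 ?(ltW G0) ?max_error_ge0 //.
rewrite [G * _]mulrC => /le_trans; apply.
have := max_error_le1 k; nra.
Qed.

(** The determinant bound would give only the square root of [D] here. Instead, [f] and [phi 0] are
    both within [d] of one line, and [f] is compared with a multiple of [phi 0]. *)
Lemma max_error1_le D : 0 <= D -> kolmogorov_width F 1 <= D ->
  max_error 1 <= 2 * (1 + eta^-1) * D.
Proof.
move=> D0 dD; have eta0 := run_eta_gt0.
have eta1 : 0 < 1 + eta^-1 by rewrite addr_gt0 ?invr_gt0.
apply/ler_addgt0Pr => e e0.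
pose d := D + e / (2 * (1 + eta^-1)).
have -> : 2 * (1 + eta^-1) * D + e = 2 * (1 + eta^-1) * d.
  by rewrite /d [RHS]mulrDr [_ * (e / _)]mulrC divfK // mulf_neq0 ?gt_eqF.
have dd : kolmogorov_width F 1 < d.
  by apply: le_lt_trans dD _; rewrite ltrDl divr_gt0 // mulr_gt0.
have d0 : 0 <= d by rewrite addr_ge0 // ltW // divr_gt0 // mulr_gt0.
have [w wF] := kolmogorov_width_lt F_neq0 (geim_norm_le1 setting) dd.
have line p : lspan (range w) p -> exists c, p = c *: w ord0.
  apply: (lspan_min (B := [set p | exists c, p = c *: w ord0])).
    split=> [|a _ _ [b ->] [c ->]] /=; first by exists 0; rewrite scale0r.
    by exists (a * b + c); rewrite scalerDl scalerA.
  by move=> _ [i _ <-]; exists 1; rewrite scale1r ord1.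
have N0 : index_le 0 N by case: N.
have phiF := run_phi_F N0.
have phi_max f : F f -> `|f| <= `|phi 0%N| / eta.
  move=> Ff; rewrite ler_pdivlMr // mulrC.
  have := run_greedy (run_wellposed N0) N0 Ff.
  by rewrite /J !interp0 !subr0.
apply: max_error_le => f Ff.
have [q /line[a ->] /ltW phiq] := wF _ phiF.
have [p /line[b ->] /ltW fp] := wF _ Ff.
have := phi_max f Ff; set s := `|phi 0%N| => fs.
have s0 : 0 <= s by exact: normr_ge0.
(* If [phi 0] is small, so is every [f]. Otherwise its approximant on the line is at least half as
   long, which bounds the ratio [t]; the error is then at most [(1 + |t|) d]. *)
have [small|big] := leP s (2 * d).
  apply: (@le_trans _ _ `|f|).
    by apply: norm_proj_compl_le => //; exact: gram_schmidt_orthoseq.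
  apply: le_trans fs _.
  apply: (@le_trans _ _ (2 * d / eta)); first by rewrite ler_pM2r ?invr_gt0.
  have : 0 < eta^-1 by rewrite invr_gt0.
  move: eta^-1 => h h0; nra.
have s_gt0 : 0 < s by apply: le_lt_trans big; rewrite mulr_ge0.
have a_ge : s / 2 <= `|a *: w ord0|.
  have := ler_normD (phi 0%N - a *: w ord0) (a *: w ord0); rewrite subrK -/s.
  by move=> h; lra.
have a0 : a != 0.
  apply: contraTneq a_ge => ->; rewrite scale0r normr0 -ltNge.
  by rewrite divr_gt0.
have b_le : `|b *: w ord0| <= s / eta + d.
  have := ler_normB f (f - b *: w ord0); rewrite opprB addrC subrK.
  by move=> h; lra.
pose t := b / a.
have t_le : `|t| <= 2 * eta^-1 + 1.
  have bE : `|b *: w ord0| = `|t| * `|a *: w ord0|.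
    by rewrite -normrZ scalerA /t divfK.
  have t0 : 0 <= `|t| by exact: normr_ge0.
  have h1 : `|t| * (s / 2) <= s / eta + d.
    by apply: le_trans b_le; rewrite bE ler_wpM2l.
  rewrite -(ler_pM2r (x := s / 2)) ?divr_gt0 //.
  apply: le_trans h1 _; move: big; move: eta^-1 => h; nra.
apply: (@le_trans _ _ `|f - t *: phi 0%N|).
  apply: run_proj_best; apply: subspaceZ; first exact: subspace_lspan.
  exact: geim_space_mem.
have -> : f - t *: phi 0%N =
    (f - b *: w ord0) - t *: (phi 0%N - a *: w ord0).
  by rewrite scalerBr scalerA /t divfK // opprB addrA subrK.
apply: le_trans (ler_normB _ _) _; rewrite normrZ.
have : `|t| * `|phi 0%N - a *: w ord0| <= (2 * eta^-1 + 1) * d by rewrite ler_pM.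
by move=> h; lra.
Qed.

End Run.

(** * Convergence rates *)

(** After squaring, this is the power [alpha] of the integer inequality, because [2 * Num.sqrt 2]
    squares to 8. *)
Lemma sqrt_powRN_le (R : realType) (alpha : R) (n l m : nat) : 0 <= alpha ->
  (0 < n)%N -> (n * n <= 8 * (l * m))%N ->
  Num.sqrt (l%:R `^ (- alpha) * m%:R `^ (- alpha)) <=
    (2 * Num.sqrt 2) `^ alpha * n%:R `^ (- alpha).
Proof.
move=> alpha0 n0 nlm.
have l0 : 0 < l%:R :> R by rewrite ltr0n; lia.
have m0 : 0 < m%:R :> R by rewrite ltr0n; lia.
have n0' : 0 < n%:R :> R by rewrite ltr0n.
set T := (2 * _) `^ alpha.
have T0 : 0 <= T by exact: powR_ge0.
have TT : T ^+ 2 = 8 `^ alpha.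
  rewrite expr2 -powRM ?mulr_ge0 ?sqrtr_ge0 //; congr (_ `^ _).
  by rewrite mulrACA -[Num.sqrt 2 * _]expr2 sqr_sqrtr //; ring.
rewrite !powRN; set A := l%:R `^ alpha; set B := m%:R `^ alpha.
set M := n%:R `^ alpha.
have A0 : 0 < A by rewrite powR_gt0.
have B0 : 0 < B by rewrite powR_gt0.
have M0 : 0 < M by rewrite powR_gt0.
have MM : M ^+ 2 <= T ^+ 2 * (A * B).
  rewrite TT expr2 -!powRM ?ler0n ?mulr_ge0 ?ler0n //.
  by apply: ge0_ler_powR; rewrite ?nnegrE ?mulr_ge0 ?ler0n // -!natrM ler_nat.
have -> : T * M^-1 = Num.sqrt ((T / M) ^+ 2).
  by rewrite sqrtr_sqr ger0_norm // divr_ge0 // ltW.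
apply: ler_wsqrtr; rewrite -invfM expr_div_n ler_pdivlMr ?exprn_gt0 //.
by rewrite mulrC ler_pdivrMr ?mulr_gt0.
Qed.

Theorem theorem5p9 (R : realType) (X : completeNormedModType R)
    (dot : {dot X for (@idfun R)})
    (dot_norm : forall x : X, `|x| ^+ 2 = dot x x)
    (F : set X) (N : option nat) (Sigma : set {linear X -> R^o})
    (eta : R) (Fs : nat -> set X) (Ss : nat -> set {linear X -> R^o})
    (phi : nat -> X) (sigma : nat -> {linear X -> R^o}) :
  geim_setting F N Sigma ->
  geim_run F N Sigma eta Fs Ss phi sigma ->
  let J := geim_interp phi sigma in
  let Lambda := lebesgue_const phi sigma in
  let gamma := fun n : nat => eta / (1 + Lambda n) in
  let d := kolmogorov_width F in
  forall C0 alpha c1 : R, 0 < C0 -> 0 < alpha -> 0 < c1 ->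
  ((forall n : nat, (1 <= n)%N -> d n <= C0 * n%:R `^ (- alpha)) ->
   forall (n : nat) (f : X), (1 <= n)%N -> index_le n N -> F f ->
     `|f - J n f|
       <= (1 + Lambda n) * C0 * beta_alg eta gamma alpha n * n%:R `^ (- alpha))
  /\
  (1 <= C0 ->
   (forall n : nat, (1 <= n)%N -> d n <= C0 * expR (- (c1 * n%:R `^ alpha))) ->
   let c2 := c1 * 2 `^ (- (2 * alpha) - 1) in
   forall (n : nat) (f : X), (1 <= n)%N -> index_le n N -> F f ->
     `|f - J n f|
       <= (1 + Lambda n) * C0 * beta_exp eta gamma n
          * expR (- (c2 * n%:R `^ alpha))).
Proof.
move=> setting run J Lambda gamma d C0 alpha c1 C00 alpha0 c10.
pose err n := max_error dot F phi n.
have le_err n f b : index_le n N -> F f -> err n <= C0 * b ->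
    `|f - J n f| <= (1 + Lambda n) * C0 * b.
  move=> nN Ff eb; apply: le_trans (run_quasi_optimal dot setting run f nN) _.
  rewrite -mulrA ler_pM2l; last first.
    by rewrite ltr_pwDl // (lebesgue_const_ge0 (run_wellposed setting run nN)).
  exact: le_trans (error_le_max dot_norm phi setting n Ff) eb.
split=> [dC n f n0 nN Ff|C01 dC c2 n f n0 nN Ff]; rewrite -mulrA;
    apply: le_err => //.
  elim/ltn_ind: n n0 nN => n IH n0 nN.
  have [n1|n2] := leqP n 1.
    have {n n1 n0 IH nN} -> : n = 1%N by lia.
    rewrite powR1 beta_alg1 mulr1 mulrC.
    apply: (max_error1_le dot_norm setting run); first exact: ltW.
    by have := dC 1%N isT; rewrite powR1 mulr1.
  move: n2 IH nN; rewrite (divn_eq n 4) mulnC.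
  have : (n %% 4 < 4)%N by rewrite ltn_mod.
  move: (n %/ 4)%N (n %% 4)%N => l k k4 n2 IH nN.
  rewrite beta_algE //.
  set l1 := (2 * l + _)%N; set c := ((k + 3) %/ 4)%N.
  have l1_gt0 : (0 < l1)%N by rewrite /l1; lia.
  have l1_lt : (l1 < 4 * l + k)%N by rewrite /l1; lia.
  have m_gt0 : (0 < l + c)%N by rewrite /c; lia.
  have cl1 : (c <= l1)%N by rewrite /c /l1; lia.
  (* A block of length [2 * (l + c)] starting at [(l1 - c).+1] ends exactly at [n]. *)
  have lastE : ((l1 - c).+1 + (l + c + (l + c))).-1 = (4 * l + k)%N.
    rewrite /l1 /c; lia.
  have numeric : ((4 * l + k) * (4 * l + k) <= 8 * (l1 * (l + c)))%N.
    have : [\/ [/\ k = 0, l1 = 2 * l & c = 0],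
        [/\ k = 1, l1 = 2 * l & c = 1], [/\ k = 2, l1 = 2 * l + 1 & c = 1]
      | [/\ k = 3, l1 = 2 * l + 2 & c = 1]]%N.
      move: k k4 @l1 @c {dC n2 IH nN l1_gt0 l1_lt m_gt0 cl1 lastE}.
      by case=> [|[|[|[|//]]]] _ l1 c;
        [constructor 1 | constructor 2 | constructor 3 | constructor 4];
        split=> //; rewrite /l1 /c; lia.
    by move=> h; move: n2; case: h => -[-> -> ->]; nia.
  (* As [c] is 0 or 1, the block starts no earlier than [l1], so the induction hypothesis at [l1]
     bounds its initial error. *)
  have l1_le : ((l1 - c).+1 >= l1)%N by rewrite /l1 /c; lia.
  have {IH} err_l1 := IH l1 l1_lt l1_gt0 (index_leW (ltnW l1_lt) nN).
  have := max_error_le_sqrt dot_norm setting run (k := (l1 - c).+1) m_gt0.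
  rewrite lastE -addnA lastE => /(_ (C0 * (l + c)%:R `^ (- alpha)) nN).
  move=> /(_ (mulr_ge0 (ltW C00) (powR_ge0 _ _)) (dC _ m_gt0)) err_n.
  apply: le_trans err_n _.
  have prodE : \prod_(1 <= i < (2 * (l + c)).+1)
        gamma (l1 - c + i)%N `^ (2 * (l + c))%:R^-1 =
      \prod_(i < l + c + (l + c))
        gamma ((l1 - c).+1 + i)%N `^ (l + c + (l + c))%:R^-1.
    rewrite big_add1 big_mkord mul2n -addnn.
    by apply: eq_bigr => i _; rewrite addSnnS.
  rewrite prodE; set G := \prod_(_ < _) _.
  have G0 : 0 < G.
    apply: (prod_gamma_root_gt0 setting run) => i ni.
    by apply: index_leW nN; rewrite -lastE; lia.
  set b1 := beta_alg _ _ _ l1; set pl := l1%:R `^ (- alpha).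
  set pm := (l + c)%:R `^ (- alpha).
  have pl0 : 0 <= pl by exact: powR_ge0.
  have pm0 : 0 <= pm by exact: powR_ge0.
  apply: (@le_trans _ _ (C0 * (Num.sqrt (2 * b1) * Num.sqrt (pl * pm)) / G)).
    rewrite ler_pM2r ?invr_gt0 //.
    have -> : C0 * (Num.sqrt (2 * b1) * Num.sqrt (pl * pm)) =
        Num.sqrt (C0 ^+ 2 * (pl * pm) * (2 * b1)).
      rewrite (@sqrtrM _ (_ * _) (2 * b1)) ?(@sqrtrM _ (C0 ^+ 2)) ?sqr_ge0 //.
        by rewrite sqrtr_sqr (gtr0_norm C00); ring.
      by rewrite mulr_ge0 ?sqr_ge0 // mulr_ge0.
    apply: ler_wsqrtr.
    have err_le : max_error dot F phi (l1 - c).+1 <= C0 * (b1 * pl).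
      exact: le_trans (max_error_anti dot_norm setting run l1_le) err_l1.
    have -> : C0 ^+ 2 * (pl * pm) * (2 * b1) = 2 * (C0 * (b1 * pl)) * (C0 * pm) by ring.
    by rewrite ler_wpM2r ?ler_pM2l // mulr_ge0 // ltW.
  set s := Num.sqrt (2 * b1).
  have -> : C0 * (s * G^-1 * (2 * Num.sqrt 2) `^ alpha * (4 * l + k)%:R `^ (- alpha)) =
      C0 * (s * ((2 * Num.sqrt 2) `^ alpha * (4 * l + k)%:R `^ (- alpha))) / G by ring.
  rewrite ler_pM2r ?invr_gt0 // ler_pM2l // ler_wpM2l ?sqrtr_ge0 //.
  by apply: sqrt_powRN_le; [exact: ltW | lia | exact: numeric].
have w_le1 : 2 `^ (- (2 * alpha) - 1) <= 1 :> R.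
  by rewrite -[leRHS](powRr0 2); apply: ler_powR; lra.
(* This explains [c2]: it gives [2 * c2 * n ^ alpha = c1 * (n / 4) ^ alpha], which is at most
   [c1 * m ^ alpha] once [n <= 4 * m]. *)
have wE : 2 * 2 `^ (- (2 * alpha) - 1) = (4 `^ alpha)^-1 :> R.
  rewrite powRD ?pnatr_eq0 ?implybT // powR_inv1 // mulrCA divff ?mulr1 //.
  by rewrite powRN powRrM powR_mulrn //; congr (_ `^ _)^-1; ring.
have [n1|n2] := leqP n 1.
  have {n1 n0 nN} -> : n = 1%N by lia.
  rewrite /beta_exp /= powR1 mulr1.
  have D0 : 0 <= C0 * expR (- c1) by rewrite mulr_ge0 ?expR_ge0 // ltW.
  have dD : d 1%N <= C0 * expR (- c1) by have := dC 1%N isT; rewrite powR1 mulr1.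
  apply: le_trans (max_error1_le dot_norm setting run D0 dD) _.
  have eta0 : 0 < 1 + eta^-1 by rewrite addr_gt0 ?invr_gt0 ?(run_eta_gt0 run).
  rewrite mulrCA ler_pM2l // ler_pM2l ?mulr_gt0 // ler_expR lerN2.
  by rewrite /c2 ler_piMr // ltW.
rewrite /beta_exp leqNgt n2 /=; set m := n./2.
have m0 : (0 < m)%N by rewrite /m; lia.
have m2n : (2 * m <= n)%N by rewrite /m; lia.
have n4m : (n <= 4 * m)%N by rewrite /m; lia.
set e := expR (- (c2 * _)).
have D0 : 0 <= C0 * expR (- (c1 * m%:R `^ alpha)).
  by rewrite mulr_ge0 ?expR_ge0 // ltW.
have lastE : (1 + (m + m)).-1 = (2 * m)%N by lia.
(* The block runs from 1 to [2 * m], the largest even index up to [n]. *)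
have := max_error_le_sqrt dot_norm setting run (k := 1) m0.
rewrite -addnA lastE => /(_ _ (index_leW m2n nN) D0 (dC m m0)) err_m.
apply: le_trans (max_error_anti dot_norm setting run m2n) _.
apply: le_trans err_m _.
have -> : \prod_(1 <= i < (2 * m).+1) gamma i `^ (2 * m)%:R^-1 =
    \prod_(i < m + m) gamma (1 + i)%N `^ (m + m)%:R^-1.
  by rewrite big_add1 big_mkord mul2n -addnn.
set G := \prod_(_ < _) _.
have G0 : 0 < G.
  apply: (prod_gamma_root_gt0 setting run) => i im.
  by apply: index_leW nN; lia.
have -> : C0 * (Num.sqrt 2 * G^-1 * e) = C0 * (Num.sqrt 2 * e) / G by ring.
rewrite ler_pM2r ?invr_gt0 //.
have -> : C0 * (Num.sqrt 2 * e) = Num.sqrt (2 * (C0 * e) ^+ 2).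
  rewrite sqrtrM // sqrtr_sqr ger0_norm ?mulr_ge0 ?expR_ge0 ?(ltW C00) //; ring.
apply: ler_wsqrtr; rewrite -mulrA ler_pM2l //.
(* The initial error is bounded by 1. Then [1 <= C0] gives [C0 <= C0 ^+ 2], and the exponential is
   compared with [e ^+ 2]. *)
apply: (@le_trans _ _ (C0 * expR (- (c1 * m%:R `^ alpha)))).
  by rewrite ler_piMl // (max_error_le1 dot_norm setting run).
rewrite exprMn ler_pM ?expR_ge0 ?(ltW C00) //.
  by rewrite expr2 ler_peMr // ltW.
rewrite expr2 -expRD ler_expR -opprD lerN2 -mulr2n -[_ *+ 2]mulr_natl.
have -> : 2 * (c2 * n%:R `^ alpha) =
    c1 * ((2 * 2 `^ (- (2 * alpha) - 1)) * n%:R `^ alpha) by rewrite /c2; ring.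
rewrite wE ler_pM2l // mulrC ler_pdivrMr ?powR_gt0 // -powRM //.
apply: ge0_ler_powR; rewrite ?nnegrE ?mulr_ge0 ?(ltW alpha0) //.
by rewrite mulrC -natrM ler_nat.
Qed.
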